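(* Let an $s$-stage explicit Runge-Kutta method with coefficients $a_{ij}$, $b_i$, $c_i$ be a 2N-storage method with 2N-storage coefficients satisfying $A_i\neq 0$ for $i=2,\dots,s$. Assume that the denominators below do not vanish, i.e. $\sum_{k=1}^{j}b_k-c_j\neq0$ for $j=1,\dots,s-1$. Then for all $i=2,\dots,s$ and $j=1,\dots,i-1$ $$a_{ij}=\frac{b_j}{\displaystyle\sum_{k=1}^{j}b_k-c_j}\left[c_i-c_j-\sum_{k=j+1}^{i-1}a_{ik}\right].$$
   Context: Empty sums equal $0$. An $s$-stage explicit Runge-Kutta method ($a$-form) has real coefficients $a_{ij}$ ($i,j=1,\dots,s$, $a_{ij}=0$ for $i\le j$), $b_i$ and nodes $c_i=\sum_{j=1}^{i-1}a_{ij}$ (so $c_1=0$). With step size $h$ it computes $y_i=y_0+h\sum_{j=1}^{i-1}a_{ij}k_j$, $k_i=f(t+c_ih,y_i)$, $i=1,\dots,s$, and $y_{s+1}=y_0+h\sum_{i=1}^s b_ik_i$. 2N-storage method ($A$-form): the method is a 2N-storage method with coefficients $A_1=0,A_2,\dots,A_s$ and $B_1,\dots,B_s$, all $B_i\ne0$, if its stages coincide (identically, as formal linear combinations of $y_0$ and $k_1,\dots,k_s$, treated as independent symbols) with those produced by $y_1=y_0$, $\Delta y_2=hk_1$, $\Delta y_i=A_{i-1}\Delta y_{i-1}+hk_{i-1}$ for $i=3,\dots,s+1$, and $y_i=y_{i-1}+B_{i-1}\Delta y_i$ for $i=2,\dots,s+1$. *)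

(* Defs.v *)
From HB Require Import structures.
From mathcomp Require Import all_boot all_order all_algebra.
From mathcomp Require Import reals.

Set Implicit Arguments.
Unset Strict Implicit.
Unset Printing Implicit Defensive.

Import Order.TTheory GRing.Theory Num.Theory.
Local Open Scope ring_scope.

(* Stages are numbered 0, ..., s-1 here, instead of the usual 1, ..., s; the
   final update y_{s+1} has number s. *)

Record explicit_rk (R : realType) (s : nat) := ExplicitRK {
  rk_a : 'M[R]_s;
  rk_b : 'rV[R]_s;
  rk_explicit : forall i j : 'I_s, (i <= j)%N -> rk_a i j = 0
}.

Definition rk_c (R : realType) (s : nat) (M : explicit_rk R s) (i : 'I_s) : R :=
  \sum_(j < s | (j < i)%N) rk_a M i j.

(* Elements of 'rV_s.+1 encode formal linear combinations of the independent
   symbols y_0, k_1, ..., k_s: coordinate 0 is the coefficient of y_0, and the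
   coordinate lift ord0 j is the coefficient of the slope of stage j. *)
Definition sym_y0 (R : realType) (s : nat) : 'rV[R]_s.+1 := delta_mx 0 ord0.

Definition sym_k (R : realType) (s : nat) (j : 'I_s) : 'rV[R]_s.+1 :=
  delta_mx 0 (lift ord0 j).

Definition rk_stage (R : realType) (s : nat) (M : explicit_rk R s) (h : R)
    (i : 'I_s) : 'rV[R]_s.+1 :=
  sym_y0 R s + h *: \sum_(j < s | (j < i)%N) rk_a M i j *: sym_k R j.

Definition rk_update (R : realType) (s : nat) (M : explicit_rk R s) (h : R) :
    'rV[R]_s.+1 :=
  sym_y0 R s + h *: \sum_(j < s) rk_b M 0 j *: sym_k R j.

(* The sequences y and dy produced by the 2N-storage recursion:  y n is the
   n-th stage in the numbering above (so y s is the final update) and dy n is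
   the increment used to pass from y n.-1 to y n.  Only y 0, ..., y s and
   dy 1, ..., dy s are constrained, and they are uniquely determined. *)
Definition two_N_recursion (R : realType) (s : nat) (A B : 'rV[R]_s) (h : R)
    (y dy : nat -> 'rV[R]_s.+1) : Prop :=
  [/\ y 0%N = sym_y0 R s,
      forall i : 'I_s, i = 0%N :> nat -> dy i.+1 = h *: sym_k R i,
      forall i : 'I_s, (0 < i)%N -> dy i.+1 = A 0 i *: dy i + h *: sym_k R i
    & forall i : 'I_s, y i.+1 = y i + B 0 i *: dy i.+1].

Definition is_two_N_storage (R : realType) (s : nat) (M : explicit_rk R s)
    (A B : 'rV[R]_s) : Prop :=
  [/\ forall i : 'I_s, i = 0%N :> nat -> A 0 i = 0,
      forall i : 'I_s, B 0 i != 0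
    & forall h : R, exists y dy : nat -> 'rV[R]_s.+1,
        [/\ two_N_recursion A B h y dy,
            forall i : 'I_s, rk_stage M h i = y i
          & rk_update M h = y s]].

(* Main.v *)
(* Write a_(s+1,k) = b_k, and let d_jk be the coefficient of h k_k in the
    increment Delta y_(j+1) leaving stage j.  From stage j on, the slopes
    k_1, ..., k_(j-1) enter only through the current increment, which is
    multiplied by the same factors A as k_j, so that
    a_nk - a_jk = d_jk a_nj whenever k <= j <= n.  Summing over k <= j,
    once with n = i and once with n = s+1, expresses both the bracket and the
    denominator as multiples, by a_ij and by b_j, of the same sum of the d_jk. *)
Require Import Defs.
From mathcomp Require Import all_boot all_order all_algebra.
From mathcomp Require Import reals.

Set Implicit Arguments.
Unset Strict Implicit.
Unset Printing Implicit Defensive.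

Import Order.TTheory GRing.Theory Num.Theory.
Local Open Scope ring_scope.

Lemma sym_kE (R : realType) (s : nat) (k j : 'I_s) :
  sym_k R k 0 (lift ord0 j) = (j == k)%:R.
Proof. by rewrite /sym_k mxE eqxx (inj_eq lift_inj). Qed.

(** The predicate [P] lets one formula serve both [rk_stage] and [rk_update]. *)
Lemma sym_combE (R : realType) (s : nat) (h : R) (P : pred 'I_s)
    (u : 'I_s -> R) (j : 'I_s) :
  (sym_y0 R s + h *: \sum_(k < s | P k) u k *: sym_k R k) 0 (lift ord0 j) =
  h * (if P j then u j else 0).
Proof.
rewrite /sym_y0 !mxE andbF add0r summxE; congr (_ * _).
rewrite big_mkcond (bigD1 j) //= [X in _ + X]big1 => [|k kj].
  by rewrite mxE sym_kE eqxx mulr1 addr0.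
by case: ifP => // _; rewrite mxE sym_kE eq_sym (negPf kj) mulr0.
Qed.

Lemma increment_coord0 (R : realType) (s : nat) (A B : 'rV[R]_s)
    (y dy : nat -> 'rV[R]_s.+1) (rec : two_N_recursion A B 1 y dy)
    (i j : 'I_s) :
  i = 0%N :> nat -> dy i.+1 0 (lift ord0 j) = (j == i)%:R.
Proof. by case: rec => _ dy1 _ _ i0; rewrite dy1 // scale1r sym_kE. Qed.

Lemma increment_coordS (R : realType) (s : nat) (A B : 'rV[R]_s)
    (y dy : nat -> 'rV[R]_s.+1) (rec : two_N_recursion A B 1 y dy)
    (i j : 'I_s) : (0 < i)%N ->
  dy i.+1 0 (lift ord0 j) = A 0 i * dy i 0 (lift ord0 j) + (j == i)%:R.
Proof.
case: rec => _ _ dyS _ i_gt0.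
by rewrite dyS // scale1r mxE sym_kE; congr (_ + _); rewrite mxE.
Qed.

Lemma increment_future0 (R : realType) (s : nat) (A B : 'rV[R]_s)
    (y dy : nat -> 'rV[R]_s.+1) (rec : two_N_recursion A B 1 y dy)
    (i j : 'I_s) :
  (i < j)%N -> dy i.+1 0 (lift ord0 j) = 0.
Proof.
case: i => n ns /=.
elim: n ns => [|n IHn] ns nj.
  by rewrite (increment_coord0 rec (i := Ordinal ns)) // -val_eqE /= gtn_eqF.
rewrite (increment_coordS rec (i := Ordinal ns)) //=.
by rewrite (IHn (ltnW ns) (ltnW nj)) mulr0 add0r -val_eqE /= gtn_eqF.
Qed.

(** The new slope enters with factor 1, and the increment carried over from the previous stage
    cannot contain it yet. *)
Lemma increment_diag (R : realType) (s : nat) (A B : 'rV[R]_s)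
    (y dy : nat -> 'rV[R]_s.+1) (rec : two_N_recursion A B 1 y dy)
    (j : 'I_s) : dy j.+1 0 (lift ord0 j) = 1.
Proof.
have [j0|j_gt0] := posnP j; first by rewrite (increment_coord0 rec) // eqxx.
have js : (j.-1 < s)%N by apply: leq_ltn_trans (ltn_ord j); exact: leq_pred.
have := increment_future0 rec (i := Ordinal js) (j := j).
rewrite /= prednK // => dj0.
by rewrite (increment_coordS rec) // eqxx dj0 // mulr0 add0r.
Qed.

(** After stage [j], the coordinates of [k] and [j] obey the same homogeneous recursion,
    multiplication by the successive [A 0 i]; hence their ratio keeps its value at [dy j.+1], where
    coordinate [j] is 1. *)
Lemma increment_factor (R : realType) (s : nat) (A B : 'rV[R]_s)
    (y dy : nat -> 'rV[R]_s.+1) (rec : two_N_recursion A B 1 y dy)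
    (i j k : 'I_s) : (k <= j <= i)%N ->
  dy i.+1 0 (lift ord0 k) = dy j.+1 0 (lift ord0 k) * dy i.+1 0 (lift ord0 j).
Proof.
case/andP=> kj; case: i => n ns /=.
elim: n ns => [|n IHn] ns.
  rewrite leqn0 => /eqP j0; have -> : j = Ordinal ns by exact: val_inj.
  by rewrite (increment_diag rec (Ordinal ns)) mulr1.
rewrite leq_eqVlt => /predU1P[<-|jn].
  by rewrite (increment_diag rec) mulr1.
rewrite !(increment_coordS rec (i := Ordinal ns)) //= -!val_eqE /=.
rewrite !ltn_eqF ?(leq_ltn_trans kj jn) // !addr0.
by rewrite (IHn (ltnW ns) jn) mulrCA.
Qed.

(** The difference of [y n] and [y j] is a combination of the increments leaving stages [j], ...,
    [n.-1], each of which factors in the same way. Here [n] is a natural number so that [n = s], the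
    final update, is included. *)
Lemma stage_factor (R : realType) (s : nat) (A B : 'rV[R]_s)
    (y dy : nat -> 'rV[R]_s.+1) (rec : two_N_recursion A B 1 y dy)
    (n : nat) (j k : 'I_s) : (k <= j <= n)%N -> (n <= s)%N ->
  y n 0 (lift ord0 k) - y j 0 (lift ord0 k) =
  dy j.+1 0 (lift ord0 k) * (y n 0 (lift ord0 j) - y j 0 (lift ord0 j)).
Proof.
case: (rec) => _ _ _ yS /andP[kj].
have yE (i : 'I_s) l : y i.+1 0 l = y i 0 l + B 0 i * dy i.+1 0 l.
  by rewrite yS mxE; congr (_ + _); rewrite mxE.
elim: n => [|n IHn].
  by rewrite leqn0 => /eqP j0 _; rewrite j0 !subrr mulr0.
rewrite leq_eqVlt => /predU1P[<- _|jn ns]; first by rewrite !subrr mulr0.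
rewrite !(yE (Ordinal ns)) /=.
rewrite (increment_factor rec (i := Ordinal ns) (j := j)) ?kj //=.
by rewrite addrAC (IHn jn (ltnW ns)) [in RHS]addrAC [RHS]mulrDr mulrCA.
Qed.

Theorem theorem4 (R : realType) (s : nat) (M : explicit_rk R s)
    (A B : 'rV[R]_s)
    (h2N : is_two_N_storage M A B)
    (hA : forall i : 'I_s, (0 < i)%N -> A 0 i != 0)
    (hden : forall j : 'I_s, (j.+1 < s)%N ->
       \sum_(k < s | (k <= j)%N) rk_b M 0 k - rk_c M j != 0) :
  forall i j : 'I_s, (j < i)%N ->
    rk_a M i j =
      rk_b M 0 j / (\sum_(k < s | (k <= j)%N) rk_b M 0 k - rk_c M j)
      * (rk_c M i - rk_c M j - \sum_(k < s | (j < k < i)%N) rk_a M i k).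
Proof.
move=> i j ji; have /hden den_neq0 : (j.+1 < s)%N by apply: leq_ltn_trans ji _.
(* With step size 1 the coordinates of the stages are the Runge-Kutta coefficients themselves. *)
case: h2N => _ _ /(_ 1)[y [dy [rec stageE updE]]].
have aE (m k : 'I_s) : y m 0 (lift ord0 k) = rk_a M m k.
  rewrite -stageE sym_combE mul1r.
  by case: ltnP => // mk; rewrite rk_explicit.
have bE k : y s 0 (lift ord0 k) = rk_b M 0 k.
  by rewrite -updE sym_combE mul1r.
have ajj0 : rk_a M j j = 0 by rewrite rk_explicit.
pose D := \sum_(k < s | (k <= j)%N) dy j.+1 0 (lift ord0 k).
(* Adding the zero diagonal term gives this sum the same range [k <= j] as the other two. *)
have cjE : rk_c M j = \sum_(k < s | (k <= j)%N) rk_a M j k.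
  rewrite /rk_c big_mkcond [RHS]big_mkcond; apply: eq_bigr => k _.
  by case: ltngtP => // /val_inj ->; rewrite ajj0.
have ciE : rk_c M i = \sum_(k < s | (k <= j)%N) rk_a M i k
                      + \sum_(k < s | (j < k < i)%N) rk_a M i k.
  rewrite /rk_c (bigID (fun k : 'I_s => (k <= j)%N)) /=.
  congr (_ + _); apply: eq_bigl => k.
    by rewrite andb_idl // => kj; apply: leq_ltn_trans kj ji.
  by rewrite -ltnNge andbC.
have denE : \sum_(k < s | (k <= j)%N) rk_b M 0 k - rk_c M j = D * rk_b M 0 j.
  rewrite cjE -sumrB mulr_suml; apply: eq_bigr => k kj.
  rewrite -bE -aE (stage_factor rec) ?kj ?(ltnW (ltn_ord j)) //.
  by rewrite bE aE ajj0 subr0.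
have numE : rk_c M i - rk_c M j - \sum_(k < s | (j < k < i)%N) rk_a M i k
            = D * rk_a M i j.
  rewrite ciE cjE addrAC addrK -sumrB mulr_suml; apply: eq_bigr => k kj.
  rewrite -!aE (stage_factor rec) ?kj ?(ltnW ji) ?(ltnW (ltn_ord i)) //.
  by rewrite !aE ajj0 subr0.
(* The product [D * rk_b M 0 j] is the nonzero denominator, so it cancels as a whole. *)
rewrite numE; move: den_neq0; rewrite denE => Db_neq0.
by rewrite mulrAC mulrA [_ * D]mulrC mulrAC mulfV ?mul1r.
Qed.
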